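(* Let $d\ge 1$ and let $X=(X_n)_{n\in\mathbb{Z}_+}$ be a discrete-time, time-homogeneous Markov process on a non-empty, unbounded Borel set $\mathbb{X}\subseteq\mathbb{R}^d$, started from a fixed (non-random) point $X_0\in\mathbb{X}$, with one-step increment $\Delta=X_1-X_0$. Suppose that the following five conditions hold. (1) There exists $p>2$ such that $\sup_{\mathbf{x}\in\mathbb{X}}\mathbb{E}_{\mathbf{x}}[\|\Delta\|^p]<\infty$. (2) $\mathbb{E}_{\mathbf{x}}[\Delta]=\mathbf{0}$ for all $\mathbf{x}\in\mathbb{X}$. (3) There exists $v>0$ such that $\mathbb{E}_{\mathbf{x}}[\|\Delta\|^2]\ge v$ for all $\mathbf{x}\in\mathbb{X}$. (4) There exists a function $\sigma^2$ from $\mathbb{S}^{d-1}$ to the positive-definite (symmetric) $d\times d$ real matrices such that $$\varepsilon(r):=\sup_{\mathbf{x}\in\mathbb{X}:\|\mathbf{x}\|\ge r}\|M(\mathbf{x})-\sigma^2(\hat{\mathbf{x}})\|_{\mathrm{op}}\to 0\quad\text{as } r\to\infty,$$ where $M(\mathbf{x}):=\mathbb{E}_{\mathbf{x}}[\Delta\Delta^{\top}]$. (5) There exist constants $U,V$ with $0<U<V<\infty$ such that, for all $\mathbf{u}\in\mathbb{S}^{d-1}$, $\mathbf{u}^{\top}\sigma^2(\mathbf{u})\mathbf{u}=U$ and $\operatorname{tr}(\sigma^2(\mathbf{u}))=V$. Suppose moreover that one of the following holds: (i) $2U<V$; (ii) $2U>V$; (iii) $2U=V$ and $\varepsilon(r)=O(r^{-\delta_0})$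 as $r\to\infty$ for some $\delta_0>0$. Then, for any bounded $A\subset\mathbb{R}^d$, $$\lim_{n\to\infty}\frac1n\sum_{k=0}^{n-1}\mathbf{1}\{X_k\in A\}=0,\quad\text{almost surely and in } L^q \text{ for any } q\ge 1.$$
   Context: $\mathbb{Z}_+=\{0,1,2,\ldots\}$. $\|\cdot\|$ is the Euclidean norm on $\mathbb{R}^d$, $\mathbb{S}^{d-1}=\{\mathbf{u}\in\mathbb{R}^d:\|\mathbf{u}\|=1\}$, and $\|M\|_{\mathrm{op}}=\sup_{\mathbf{u}\in\mathbb{S}^{d-1}}\|M\mathbf{u}\|$. For $\mathbf{x}\ne\mathbf{0}$, $\hat{\mathbf{x}}=\mathbf{x}/\|\mathbf{x}\|$, and $\hat{\mathbf{0}}=\mathbf{e}_1$ (first standard basis vector). Vectors are column vectors. $\mathbb{P}_{\mathbf{x}}$ and $\mathbb{E}_{\mathbf{x}}$ denote probability and expectation for the process started from $X_0=\mathbf{x}\in\mathbb{X}$. By the time-homogeneous Markov property, given $X_0,\ldots,X_n$, the law of $X_{n+1}-X_n$ depends only on $X_n$ and, given $X_n=\mathbf{x}$, equals the law of $\Delta$ under $\mathbb{P}_{\mathbf{x}}$. $\mathbf{1}\{\cdot\}$ denotes the indicator. *)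

(* Defs.v *)
From HB Require Import structures.
From mathcomp Require Export all_boot all_order all_algebra.
From mathcomp Require Export all_classical all_reals all_analysis.
Export Order.TTheory GRing.Theory Num.Theory numFieldNormedType.Exports.

Set Implicit Arguments.
Unset Strict Implicit.
Unset Printing Implicit Defensive.

Local Open Scope classical_set_scope.
Local Open Scope ring_scope.

(* R^d as column vectors, with its Borel sigma-algebra.  The type is convertible
   to 'cV[R]_d.  The topology is the product topology; it is induced by the
   library's max norm `|x| as well as by the Euclidean norm below. *)
Definition Rvec (R : realType) (d : nat) :=
  g_sigma_algebraType (@open 'cV[R]_d).

Section Euclidean.
Variables (R : realType) (d : nat).
Implicit Types (x u : 'cV[R]_d) (M : 'M[R]_d) (A : set 'cV[R]_d).

(* The library's norm `|x| on 'cV[R]_d is the max norm. *)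
Definition enorm x : R := Num.sqrt (\sum_(i < d) x i 0 ^+ 2).

Definition usphere : set 'cV[R]_d := [set u | enorm u = 1].

Definition opnorm M : R := sup [set enorm (M *m u) | u in usphere].

Definition e1 : 'cV[R]_d := \col_(i < d) ((i : nat) == 0%N)%:R.

Definition hat x : 'cV[R]_d := if x == 0 then e1 else (enorm x)^-1 *: x.

Definition posdef M : Prop :=
  M^T = M /\ forall u, u != 0 -> 0 < (u^T *m M *m u) 0 0.

Definition ebounded A : Prop := exists r : R, forall x, A x -> enorm x <= r.

End Euclidean.

Arguments usphere {R d}.
Arguments e1 {R d}.

Section Markov.
Variables (R : realType) (d : nat).

(* [K] is the transition kernel of a Markov process on the Borel set [S]: for x
   in S, [K x] is the law of X_1 under P_x, and it is carried by [S].  Only the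
   restriction of [K] to [S] matters; a kernel on a Borel set [S] always extends
   to the whole space, for instance by Dirac masses off [S].
   The last field is the time-homogeneous Markov property with respect to the
   natural filtration: P(X_(n+1) \in B | X_0, ..., X_n) = K(X_n, B) a.s., with
   the conditional probability characterized by its integrals over the events
   of sigma(X_0, ..., X_n). *)
Record markov_process (S : set (Rvec R d)) (K : R.-pker Rvec R d ~> Rvec R d)
    (x0 : Rvec R d) (dO : measure_display) (Omega : measurableType dO)
    (P : probability Omega R) (X : nat -> Omega -> Rvec R d) : Prop := {
  markov_kernel_carried : forall x, S x -> K x S = 1%E;
  markov_measurable : forall n, measurable_fun [set: Omega] (X n);
  markov_in : forall n w, S (X n w);
  markov_start : forall w, X 0%N w = x0;
  markov_step : forall (n : nat) (E : set Omega) (B : set (Rvec R d)),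
    g_sigma_preimage (fun k : 'I_n.+1 => X k) E -> measurable B ->
    P (E `&` X n.+1 @^-1` B) = (\int[P]_(w in E) K (X n w) B)%E }.

Variable K : R.-pker Rvec R d ~> Rvec R d.
Implicit Type x : 'cV[R]_d.

(* E_x[f(Delta)], Delta = X_1 - X_0, where X_1 has law [K x] under P_x *)
Definition incr_expect x (f : 'cV[R]_d -> \bar R) : \bar R :=
  (\int[K x]_y f ((y : 'cV[R]_d) - x)%R)%E.

(* M(x) = E_x[Delta Delta^T]; its entries are finite under the moment assumption
   of order p > 2 *)
Definition incr_cov x : 'M[R]_d :=
  \matrix_(i < d, j < d)
    fine (incr_expect x (fun D : 'cV[R]_d => ((D *m D^T) i j)%:E)).

(* epsilon(r), extended-real valued since it may be infinite for small r *)
Definition cov_err (S : set 'cV[R]_d) (sigma2 : 'cV[R]_d -> 'M[R]_d) (r : R)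
    : \bar R :=
  ereal_sup [set (opnorm (incr_cov x - sigma2 (hat x)))%:E
            | x in [set x | S x /\ r <= enorm x]].

End Markov.

(* (1/n) sum_(k < n) 1{X_k \in A} (equal to 0 at n = 0) *)
Definition occupation (R : realType) (d : nat) (T : Type)
    (X : nat -> T -> 'cV[R]_d) (A : set 'cV[R]_d) (n : nat) (w : T) : R :=
  n%:R^-1 * \sum_(k < n) \1_A (X k w).

(* Main.v *)
From HB Require Import structures.
Require Import Defs.
From mathcomp Require Import ring lra measurable_realfun giry.

(** The function [f(x) = sqrt (1 + |x|^2)] is convex, so by the zero drift its
    expected one-step increment is nonnegative everywhere; on a ball it is bounded
    below by a constant [c > 0], because the variance is bounded below and the
    moments of order [p > 2] forbid that the variance is carried by large jumps only.
    Summing along the chain, [c E(number of visits to the ball before n)] is at most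
    [E f(X_n)], which is [O(sqrt n)] since [E |X_n|^2] grows at most linearly.
    Hence the expected occupation is [O(n^(-1/2))].  This gives convergence in L^q,
    as the occupation lies in [0, 1], and almost sure convergence along [n = 4^k],
    which extends to all [n] because the number of visits is nondecreasing. *)

Set Implicit Arguments.
Unset Strict Implicit.
Unset Printing Implicit Defensive.

Local Open Scope classical_set_scope.
Local Open Scope ring_scope.

(** * Convexity, growth and measurability of the bracket [sqrt (1 + |x|^2)] *)

Section japanese_bracket.
Variables (R : realType) (d : nat).
Implicit Types x y : 'cV[R]_d.

Definition sqnorm x : R := \sum_(i < d) x i 0 ^+ 2.

Definition dotv x y : R := \sum_(i < d) x i 0 * y i 0.

(** Unlike the norm, it is strictly convex in the radial direction too, and being at least 1 it can
    safely be divided by. *)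
Definition bracket x : R := Num.sqrt (1 + sqnorm x).

Lemma sqnorm_ge0 x : 0 <= sqnorm x.
Proof. by apply: sumr_ge0 => i _; exact: sqr_ge0. Qed.

Lemma enorm_sqr x : enorm x ^+ 2 = sqnorm x.
Proof. by rewrite /enorm sqr_sqrtr// sqnorm_ge0. Qed.

Lemma enorm_ge0 x : 0 <= enorm x.
Proof. exact: sqrtr_ge0. Qed.

Lemma bracket_sqr x : bracket x ^+ 2 = 1 + sqnorm x.
Proof. by rewrite sqr_sqrtr// addr_ge0// sqnorm_ge0. Qed.

Lemma bracket_ge1 x : 1 <= bracket x.
Proof. by rewrite -[leLHS]sqrtr1 ler_wsqrtr// lerDl sqnorm_ge0. Qed.

(** Cauchy-Schwarz: the squared coordinates of [|x|^2 y - (dotv x y) x] sum to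
    [|x|^2 (|x|^2 |y|^2 - (dotv x y)^2)], and [|x|^2] can be divided out unless [x] vanishes. *)
Lemma dotv_sqr_le x y : dotv x y ^+ 2 <= sqnorm x * sqnorm y.
Proof.
have [x0|xn0] := eqVneq (sqnorm x) 0.
  suff -> : dotv x y = 0 by rewrite x0 mul0r expr0n.
  rewrite /dotv big1// => i _.
  move/eqP : x0; rewrite /sqnorm psumr_eq0; last by move=> *; exact: sqr_ge0.
  move=> /allP /(_ i); rewrite mem_index_enum/= sqrf_eq0 => /(_ isT) /eqP ->.
  by rewrite mul0r.
have xgt0 : 0 < sqnorm x by rewrite lt_def xn0 sqnorm_ge0.
have : 0 <= \sum_(i < d) (sqnorm x * y i 0 - dotv x y * x i 0) ^+ 2.
  by apply: sumr_ge0 => i _; exact: sqr_ge0.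
rewrite (eq_bigr (fun i => sqnorm x ^+ 2 * y i 0 ^+ 2
    - 2 * sqnorm x * dotv x y * (x i 0 * y i 0)
    + dotv x y ^+ 2 * x i 0 ^+ 2)); last by move=> i _; ring.
rewrite big_split sumrB/= -!mulr_sumr -/(sqnorm x) -/(sqnorm y) -/(dotv x y).
rewrite [leRHS](_ : _ = sqnorm x * (sqnorm x * sqnorm y - dotv x y ^+ 2)).
  by rewrite pmulr_rge0// subr_ge0.
by ring.
Qed.

Lemma sqnorm_shift x y :
  sqnorm y = sqnorm x + 2 * dotv x (y - x) + sqnorm (y - x).
Proof.
rewrite /sqnorm /dotv mulr_sumr -!big_split/=; apply: eq_bigr => i _.
by rewrite !mxE; ring.
Qed.

(* The gain comes from [a b - (a^2 + c) = ((a b)^2 - (a^2 + c)^2) / (a b + a^2 + c)],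
   with numerator at least [t^2] and denominator at most [2 a (a + t)]. *)
Lemma bracket_gain_real (a b c t : R) : 1 <= a -> 0 <= b -> 0 <= t ->
  c ^+ 2 <= (a ^+ 2 - 1) * t ^+ 2 -> b ^+ 2 = a ^+ 2 + 2 * c + t ^+ 2 ->
  a + a^-1 * c + t ^+ 2 / (2 * a ^+ 2 * (a + t)) <= b.
Proof.
move=> a1 b0 t0 hc hb.
have a0 : 0 < a by apply: lt_le_trans a1.
have a0' := ltW a0.
have at0 : 0 <= a + t by lra.
have at0' : 0 < a + t by lra.
have cat : `|c| <= a * t.
  rewrite -(ler_pXn2r (n:=2)) ?nnegrE ?normr_ge0 ?mulr_ge0//.
  rewrite real_normK ?num_real// exprMn; apply: (le_trans hc).
  by rewrite mulrBl mul1r gerBl sqr_ge0.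
have [c1 c2] : - (a * t) <= c /\ c <= a * t by apply/andP; rewrite -ler_norml.
have bat : b <= a + t.
  by rewrite -(ler_pXn2r (n:=2)) ?nnegrE//; lra.
(* Expanding with [hb], the difference of the two squares is [a^2 t^2 - c^2], which is at least
   [t^2] by [hc]. *)
have prodge : (a ^+ 2 + c) ^+ 2 + t ^+ 2 <= (a * b) ^+ 2.
  by rewrite mulrBl mul1r in hc; rewrite exprMn hb !mulrDr; lra.
have ab0 : 0 <= a * b by rewrite mulr_ge0.
have cab : a ^+ 2 + c <= a * b.
  have [h|/ltW h] := leP (a ^+ 2 + c) 0; first exact: le_trans ab0.
  rewrite -(ler_pXn2r (n:=2)) ?nnegrE//.
  by apply: le_trans prodge; rewrite lerDl sqr_ge0.
have gain : t ^+ 2 <= (a * b - (a ^+ 2 + c)) * (2 * a * (a + t)).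
  apply: (@le_trans _ _ ((a * b - (a ^+ 2 + c)) * (a * b + (a ^+ 2 + c)))).
    by rewrite [leRHS](_ : _ = (a * b) ^+ 2 - (a ^+ 2 + c) ^+ 2); [lra|ring].
  rewrite ler_wpM2l ?subr_ge0//.
  have : a * b <= a * (a + t) by rewrite ler_pM2l.
  by lra.
have -> : a + a^-1 * c + t ^+ 2 / (2 * a ^+ 2 * (a + t))
    = (a ^+ 2 + c + t ^+ 2 / (2 * a * (a + t))) / a.
  by field; rewrite gt_eqF// gt_eqF.
rewrite ler_pdivrMr// -lerBrDl ler_pdivrMr; last by rewrite !mulr_gt0.
by rewrite [b * a]mulrC.
Qed.

(** Quantitative convexity: the linear term is the differential of [bracket] at [x] applied to the
    jump, and averages to zero under zero drift. The quotient is the gain, quadratic for small jumps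
    and linear for large ones. *)
Lemma bracket_gain x y :
  bracket x + (bracket x)^-1 * dotv x (y - x)
    + enorm (y - x) ^+ 2 / (2 * bracket x ^+ 2 * (bracket x + enorm (y - x)))
  <= bracket y.
Proof.
apply: bracket_gain_real; rewrite ?bracket_ge1 ?enorm_ge0 ?sqrtr_ge0//.
  by rewrite bracket_sqr addrAC subrr add0r enorm_sqr dotv_sqr_le.
by rewrite !bracket_sqr enorm_sqr (sqnorm_shift x y) -!addrA.
Qed.

(** Squaring reduces this Lipschitz bound to Cauchy-Schwarz; it serves to show that [bracket] is
    integrable after one step. *)
Lemma bracket_le_add x y : bracket y <= bracket x + enorm (y - x).
Proof.
rewrite -(ler_pXn2r (n:=2)) ?nnegrE ?addr_ge0 ?sqrtr_ge0//.
rewrite sqrrD bracket_sqr (sqnorm_shift x y) bracket_sqr enorm_sqr.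
suff : dotv x (y - x) <= bracket x * enorm (y - x) by lra.
apply: le_trans (ler_norm _) _.
rewrite -(ler_pXn2r (n:=2)) ?nnegrE ?mulr_ge0 ?sqrtr_ge0//.
rewrite real_normK ?num_real// exprMn bracket_sqr enorm_sqr.
apply: le_trans (dotv_sqr_le _ _) _.
by rewrite ler_wpM2r ?sqnorm_ge0// lerDr.
Qed.

Lemma measurable_coord i :
  measurable_fun [set: Rvec R d] (fun y : Rvec R d => (y : 'cV[R]_d) i 0).
Proof.
(* Open intervals generate the Borel sets of the line, and their preimages are open by
   continuity. *)
apply: (measurability _ (RGenOpens.measurableE R)) => _ [_ [a [b ->] <-]].
rewrite setTI; apply: sub_sigma_algebra.
have /continuousP := @coord_continuous R d 1 i 0.
by apply; exact: interval_open.
Qed.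

Lemma measurable_coordB x i : measurable_fun [set: Rvec R d]
  (fun y : Rvec R d => ((y : 'cV[R]_d) - x) i 0).
Proof.
rewrite (_ : (fun _ => _) = fun y : Rvec R d => (y : 'cV[R]_d) i 0 - x i 0).
  by apply: measurable_funB => //; exact: measurable_coord.
by apply/funext => y; rewrite !mxE.
Qed.

Lemma measurable_sqnormB x : measurable_fun [set: Rvec R d]
  (fun y : Rvec R d => sqnorm ((y : 'cV[R]_d) - x)).
Proof.
apply: measurable_sum => i; apply: measurable_funX.
exact: measurable_coordB.
Qed.

Lemma measurable_sqnorm :
  measurable_fun [set: Rvec R d] (sqnorm : Rvec R d -> R).
Proof.
apply: measurable_sum => i; apply: measurable_funX; exact: measurable_coord.
Qed.

Lemma measurable_sqrtr : measurable_fun [set: R] (@Num.sqrt R).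
Proof. by apply: continuous_measurable_fun; exact: sqrt_continuous. Qed.

Lemma measurable_enormB x : measurable_fun [set: Rvec R d]
  (fun y : Rvec R d => enorm ((y : 'cV[R]_d) - x)).
Proof. exact: (measurableT_comp measurable_sqrtr (measurable_sqnormB x)). Qed.

Lemma measurable_bracket :
  measurable_fun [set: Rvec R d] (bracket : Rvec R d -> R).
Proof.
apply: (measurableT_comp measurable_sqrtr).
by apply: measurable_funD => //; exact: measurable_sqnorm.
Qed.

End japanese_bracket.

(** * Comparison of squares with [p]-th powers *)

Lemma sqr_le1_powR (R : realType) (p t : R) : 2 < p -> 0 <= t ->
  t ^+ 2 <= 1 + t `^ p.
Proof.
move=> p2 t0; have [t1|t1] := leP t 1.
  apply: (@le_trans _ _ 1); last by rewrite lerDl powR_ge0.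
  by rewrite expr_le1.
apply: (@le_trans _ _ (t `^ p)); last by rewrite lerDr ler01.
by rewrite -powR_mulrn// ler_powR// ltW.
Qed.

(* [B := eta^(1/(2-p))] is the level with [eta B^p = B^2]: for [t > B] the left-hand
   side is nonpositive, and for [t <= B] one may drop [eta t^p]. *)
Lemma truncated_sqr_le (R : realType) (p eta rho a t : R) : 2 < p -> 0 < eta ->
  1 <= a -> a <= rho -> 0 <= t ->
  (2 * rho ^+ 2 * (rho + eta `^ (2 - p)^-1))^-1 * (t ^+ 2 - eta * t `^ p)
  <= t ^+ 2 / (2 * a ^+ 2 * (a + t)).
Proof.
move=> p2 eta0 a1 arho t0.
set B := eta `^ _.
have B0 : 0 < B by exact: powR_gt0.
have rho0 : 0 < rho by lra.
have den0 : 0 < 2 * rho ^+ 2 * (rho + B).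
  by rewrite !mulr_gt0// ?exprn_gt0// addr_gt0.
have den1 : 0 < 2 * a ^+ 2 * (a + t).
  by rewrite !mulr_gt0// ?exprn_gt0//; lra.
have [tB|Bt] := leP t B.
  rewrite mulrC; apply: (@le_trans _ _ (t ^+ 2 / (2 * rho ^+ 2 * (rho + B)))).
    rewrite ler_pM2r ?invr_gt0// gerBl mulr_ge0// ?powR_ge0//; lra.
  rewrite ler_wpM2l ?sqr_ge0// lef_pV2 ?posrE//.
  apply: ler_pM; [by rewrite mulr_ge0// sqr_ge0|lra| |lra].
  by rewrite ler_pM2l// ler_pXn2r ?nnegrE//; lra.
apply: (@le_trans _ _ 0); last by rewrite divr_ge0 ?sqr_ge0// ltW.
rewrite pmulr_rle0 ?invr_gt0// subr_le0.
have tgt0 : 0 < t by exact: lt_trans Bt.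
have etaE : B `^ (2 - p) = eta.
  by rewrite -powRrM mulVf ?powRr1 ?(ltW eta0)//; apply/eqP; lra.
have -> : t `^ p = t ^+ 2 * t `^ (p - 2).
  by rewrite -powR_mulrn ?ltW// -powRD ?(gt_eqF tgt0) ?implybT//; congr powR; lra.
rewrite mulrCA ler_peMr ?sqr_ge0//.
(* With [eta] written as [B^(2-p)], it remains that [B^(p-2) <= t^(p-2)]. *)
rewrite -etaE -(opprB p 2) powRN mulrC ler_pdivlMr ?powR_gt0// mul1r.
by apply: ge0_ler_powR; rewrite ?nnegrE; lra.
Qed.

(** * Integrability of real-valued functions *)

Section integrable_EFin.
Context dT (T : measurableType dT) (R : realType).
Variable mu : {measure set T -> \bar R}.
Implicit Types f g : T -> R.

Lemma integrableD_EFin f g : mu.-integrable setT (EFin \o f) ->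
  mu.-integrable setT (EFin \o g) ->
  mu.-integrable setT (EFin \o (fun y => f y + g y)).
Proof. by move=> fi gi; exact: (integrableD _ fi gi). Qed.

Lemma integrableZl_EFin (k : R) f : mu.-integrable setT (EFin \o f) ->
  mu.-integrable setT (EFin \o (fun y => k * f y)).
Proof. by move=> fi; exact: (integrableZl _ k fi). Qed.

Lemma EFin_Rintegral f : mu.-integrable setT (EFin \o f) ->
  ((\int[mu]_y f y)%:E = \int[mu]_y (f y)%:E)%E.
Proof. by move=> fi; rewrite fineK//; exact: integrable_fin_num. Qed.

End integrable_EFin.

(** * One step of the chain from [x], with [mu] the law of the next position *)

Section one_step.
Variables (R : realType) (d : nat) (mu : probability (Rvec R d) R).
Variables (x : 'cV[R]_d) (p Cp v : R).
Hypotheses (p2 : 2 < p)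
  (moment : (\int[mu]_y (enorm ((y : 'cV[R]_d) - x) `^ p)%:E <= Cp%:E)%E)
  (drift0 : forall i : 'I_d, (\int[mu]_y (((y : 'cV[R]_d) - x) i 0)%:E = 0)%E)
  (variance : (v%:E <= \int[mu]_y (enorm ((y : 'cV[R]_d) - x) ^+ 2)%:E)%E).

Let D (y : Rvec R d) := enorm ((y : 'cV[R]_d) - x).

Let mD : measurable_fun setT D. Proof. exact: measurable_enormB. Qed.

Let mDp : measurable_fun setT (fun y => D y `^ p).
Proof. exact: (measurableT_comp (measurable_powR p) mD). Qed.

Let integrable_p : mu.-integrable setT (EFin \o (fun y => D y `^ p)).
Proof.
apply/integrableP; split; first exact/measurable_EFinP.
rewrite (eq_integral (fun y => (D y `^ p)%:E)); last first.
  by move=> y _ /=; rewrite ger0_norm// powR_ge0.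
exact: le_lt_trans moment (ltry _).
Qed.

Let integrable_1p : mu.-integrable setT (EFin \o (fun y => 1 + D y `^ p)).
Proof. by apply: integrableD_EFin => //; exact: finite_measure_integrable_cst. Qed.

Let integrable_2 : mu.-integrable setT (EFin \o (fun y => D y ^+ 2)).
Proof.
apply: le_integrable integrable_1p => //.
  by apply/measurable_EFinP; exact: measurable_funX.
move=> y _ /=; rewrite lee_fin !ger0_norm ?sqr_ge0 ?addr_ge0 ?powR_ge0//.
by rewrite sqr_le1_powR// enorm_ge0.
Qed.

Let integrable_1 : mu.-integrable setT (EFin \o D).
Proof.
have : mu.-integrable setT (EFin \o (fun y => 1 + D y ^+ 2)).
  by apply: integrableD_EFin => //; exact: finite_measure_integrable_cst.
apply: le_integrable => //; first exact/measurable_EFinP.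
move=> y _ /=; rewrite lee_fin !ger0_norm ?addr_ge0 ?sqr_ge0 ?enorm_ge0//.
have := sqr_ge0 (D y - 1); have := sqr_ge0 (D y); rewrite sqrrB1; lra.
Qed.

Let coord_le (y : 'cV[R]_d) i : `|y i 0| <= enorm y.
Proof.
rewrite -(ler_pXn2r (n:=2)) ?nnegrE ?enorm_ge0// enorm_sqr real_normK ?num_real//.
by rewrite /sqnorm (bigD1 i)//= lerDl sumr_ge0// => j _; exact: sqr_ge0.
Qed.

Let integrable_incr i :
  mu.-integrable setT (EFin \o (fun y : Rvec R d => ((y : 'cV[R]_d) - x) i 0)).
Proof.
apply: le_integrable integrable_1 => //.
  by apply/measurable_EFinP; exact: measurable_coordB.
move=> y _ /=; rewrite lee_fin [leRHS]ger0_norm ?enorm_ge0//; exact: coord_le.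
Qed.

Let integrable_dot :
  mu.-integrable setT (EFin \o (fun y : Rvec R d => dotv x ((y : 'cV[R]_d) - x))).
Proof.
rewrite (_ : EFin \o _ = fun y : Rvec R d =>
    (\sum_(i < d) (x i 0)%:E * (((y : 'cV[R]_d) - x) i 0)%:E)%E).
  apply: integrable_sum => // i _.
  exact: (integrableZl measurableT (x i 0) (integrable_incr i)).
by apply/funext => y /=; rewrite -sumEFin.
Qed.

Let integral_dot : \int[mu]_y dotv x ((y : 'cV[R]_d) - x) = 0.
Proof.
rewrite /Rintegral (eq_integral (fun y : Rvec R d =>
    (\sum_(i < d) (x i 0)%:E * (((y : 'cV[R]_d) - x) i 0)%:E)%E)); last first.
  by move=> y _; rewrite -sumEFin.
rewrite integral_sum//; last first.
  by move=> i; exact: (integrableZl measurableT (x i 0) (integrable_incr i)).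
rewrite big1// => i _.
by rewrite (integralZl measurableT (integrable_incr i)) drift0 mule0.
Qed.

Let integrable_bracket : mu.-integrable setT (EFin \o (@bracket R d : Rvec R d -> R)).
Proof.
have : mu.-integrable setT (EFin \o (fun y => bracket x + D y)).
  by apply: integrableD_EFin => //; exact: finite_measure_integrable_cst.
apply: le_integrable => //; first by apply/measurable_EFinP; exact: measurable_bracket.
move=> y _ /=; rewrite lee_fin !ger0_norm ?addr_ge0 ?sqrtr_ge0//.
exact: bracket_le_add.
Qed.

Let mu1 : fine (mu [set: Rvec R d]) = 1.
Proof. by rewrite (@probability_setT _ _ _ mu). Qed.

(** Integrating [bracket_gain] removes the linear term; the gain is replaced by the minorant
    [kappa (t^2 - eta t^p)], whose mean is controlled by the variance and the moment. The factor
    [kappa] is left free: it is positive on a ball and 0 outside. *)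
Lemma bracket_drift_ge (kappa eta : R) : 0 <= kappa -> 0 <= eta ->
  (forall t, 0 <= t -> kappa * (t ^+ 2 - eta * t `^ p)
     <= t ^+ 2 / (2 * bracket x ^+ 2 * (bracket x + t))) ->
  ((bracket x + kappa * (v - eta * Cp))%:E <= \int[mu]_y (bracket y)%:E)%E.
Proof.
move=> kappa0 eta0 trunc.
have int_eta : mu.-integrable setT (EFin \o (fun y => - eta * D y `^ p)).
  exact: integrableZl_EFin.
have int_diff : mu.-integrable setT
    (EFin \o (fun y => D y ^+ 2 + - eta * D y `^ p)) by exact: integrableD_EFin.
have int_kdiff : mu.-integrable setT
    (EFin \o (fun y => kappa * (D y ^+ 2 + - eta * D y `^ p))).
  exact: integrableZl_EFin.
have int_lin : mu.-integrable setT
    (EFin \o (fun y : Rvec R d => (bracket x)^-1 * dotv x ((y : 'cV[R]_d) - x))).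
  exact: integrableZl_EFin.
have int_cst : mu.-integrable setT (EFin \o (fun _ : Rvec R d => bracket x)).
  exact: finite_measure_integrable_cst.
have int_aff : mu.-integrable setT (EFin \o (fun y : Rvec R d =>
    bracket x + (bracket x)^-1 * dotv x ((y : 'cV[R]_d) - x))).
  exact: integrableD_EFin.
rewrite -EFin_Rintegral// lee_fin.
apply: (@le_trans _ _ (\int[mu]_y (bracket x
    + (bracket x)^-1 * dotv x ((y : 'cV[R]_d) - x)
    + kappa * (D y ^+ 2 + - eta * D y `^ p)))); last first.
  apply: le_Rintegral => //; first exact: integrableD_EFin.
  move=> y _; apply: le_trans (bracket_gain x y).
  by rewrite lerD2l mulNr; apply: trunc; exact: enorm_ge0.
have lin0 : \int[mu]_y ((bracket x)^-1 * dotv x ((y : 'cV[R]_d) - x)) = 0.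
  by rewrite RintegralZl// integral_dot mulr0.
rewrite RintegralD// RintegralD// lin0 addr0.
rewrite Rintegral_cst// mu1 mulr1 lerD2l RintegralZl//.
rewrite ler_wpM2l// RintegralD// RintegralZl// mulNr lerB//.
  by rewrite -lee_fin EFin_Rintegral.
by rewrite ler_wpM2l// -lee_fin EFin_Rintegral.
Qed.

(** In [|y|^2 = |x|^2 + 2 dotv x (y - x) + |y - x|^2] the middle term has mean zero, and the last
    one is at most [1 + |y - x|^p]. *)
Lemma bracket_sqr_step_le :
  (\int[mu]_y (bracket y ^+ 2)%:E <= (bracket x ^+ 2 + (1 + Cp))%:E)%E.
Proof.
have int_lin : mu.-integrable setT
    (EFin \o (fun y : Rvec R d => 2 * dotv x ((y : 'cV[R]_d) - x))).
  exact: integrableZl_EFin.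
have int_cst : mu.-integrable setT (EFin \o (fun _ : Rvec R d => bracket x ^+ 2)).
  exact: finite_measure_integrable_cst.
have int_one : mu.-integrable setT (EFin \o (fun _ : Rvec R d => 1 : R)).
  exact: finite_measure_integrable_cst.
have int_aff : mu.-integrable setT (EFin \o (fun y : Rvec R d =>
    bracket x ^+ 2 + 2 * dotv x ((y : 'cV[R]_d) - x))).
  exact: integrableD_EFin.
have int_all : mu.-integrable setT (EFin \o (fun y : Rvec R d =>
    bracket x ^+ 2 + 2 * dotv x ((y : 'cV[R]_d) - x) + (1 + D y `^ p))).
  exact: integrableD_EFin.
apply: (@le_trans _ _ (\int[mu]_y (bracket x ^+ 2
    + 2 * dotv x ((y : 'cV[R]_d) - x) + (1 + D y `^ p))%:E)%E).
  apply: ge0_le_integral => //.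
  - by move=> y _; rewrite lee_fin sqr_ge0.
  - by apply/measurable_EFinP/measurable_funX; exact: measurable_bracket.
  - exact: measurable_int int_all.
  - move=> y _; rewrite lee_fin !bracket_sqr (sqnorm_shift x y).
    have := sqr_le1_powR p2 (enorm_ge0 ((y : 'cV[R]_d) - x)).
    by rewrite /D enorm_sqr; lra.
have lin0 : \int[mu]_y (2 * dotv x ((y : 'cV[R]_d) - x)) = 0.
  by rewrite RintegralZl// integral_dot mulr0.
rewrite -EFin_Rintegral// lee_fin RintegralD// RintegralD// lin0 addr0.
rewrite Rintegral_cst// mu1 mulr1.
rewrite lerD2l RintegralD// Rintegral_cst// mu1 mulr1 lerD2l.
by rewrite -lee_fin EFin_Rintegral.
Qed.

End one_step.

(** * Convergence of averages, and integrals of nonnegative functions *)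

Lemma mean_cvg0_subseq4 (R : realType) (u : nat -> R) : (forall i, 0 <= u i) ->
  (4 ^ k.+1)%:R^-1 * \sum_(i < 4 ^ k.+1) u i @[k --> \oo] --> (0 : R) ->
  n%:R^-1 * \sum_(i < n) u i @[n --> \oo] --> (0 : R).
Proof.
move=> u0 /cvgr0_norm_lt sub0; apply/cvgr0Pnorm_lt => e e0.
(* For [4^k <= n < 4^(k+1)] the partial sum at [n] is at most the one at [4^(k+1)], while [1/n] is
   at most 4 times [1/4^(k+1)]; hence the tolerance [e / 4]. *)
have [K _ subK] := sub0 (e / 4) ltac:(by rewrite divr_gt0).
exists (4 ^ K)%N => // n /= Kn.
have n0 : (0 < n)%N by apply: leq_trans Kn; rewrite expn_gt0.
have /andP[kn nk] := trunc_log_bounds (isT : 1 < 4)%N n0.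
set k := trunc_log 4 n in kn nk.
have Kk : (K <= k)%N.
  by rewrite -ltnS -(ltn_exp2l _ _ (isT : 1 < 4)%N) (leq_ltn_trans Kn).
have mean_ge0 m : 0 <= m%:R^-1 * \sum_(i < m) u i.
  by rewrite mulr_ge0 ?invr_ge0// sumr_ge0.
have := subK k Kk; rewrite !ger0_norm// ltr_pdivlMr// => /le_lt_trans; apply.
rewrite mulrAC; apply: ler_pM; rewrite ?invr_ge0// ?sumr_ge0//.
  rewrite [leRHS]mulrC -[leRHS]invf_div lef_pV2 ?posrE ?divr_gt0 ?ltr0n ?expn_gt0//.
  by rewrite ler_pdivrMr// -natrM ler_nat mulnC expnS leq_mul2l.
rewrite -!(big_mkord xpredT u) [leRHS](big_cat_nat (n := n))//= ?(ltnW nk)//.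
by rewrite lerDl sumr_ge0.
Qed.

Section nonneg_integral.
Local Open Scope ereal_scope.
Context dT (T : measurableType dT) (R : realType).
Variable mu : {measure set T -> \bar R}.

(* The bounded set of the theorem need not be Borel, so the occupation to be
   integrated may fail to be measurable. *)
Lemma ge0_le_integral_nonmeasurable (f g : T -> \bar R) : (forall x, 0 <= f x) ->
  (forall x, f x <= g x) -> \int[mu]_x f x <= \int[mu]_x g x.
Proof.
move=> f0 fg.
have g0 x : 0 <= g x by exact: le_trans (fg x).
rewrite !ge0_integralTE//; apply: ereal_sup_le => _ [h hf <-].
by exists h => // x; exact: le_trans (fg x).
Qed.

(** The bounds form a geometric series of sum [C], so the series of the [f k] has a finite integral.
    It is thus finite almost everywhere, and there its terms tend to 0. *)
Lemma ae_cvg0_summable (f : nat -> T -> R) (C : R) : (0 <= C)%R ->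
  (forall k, measurable_fun setT (f k)) -> (forall k x, (0 <= f k x)%R) ->
  (forall k, \int[mu]_x (f k x)%:E <= (C / (2 ^ k.+1)%:R)%:E) ->
  {ae mu, forall x, f k x @[k --> \oo] --> (0 : R)%R}.
Proof.
move=> C0 mf f0 intf.
have mEf k : measurable_fun setT (fun x => (f k x)%:E).
  exact/measurable_EFinP.
have sum_int : mu.-integrable setT (fun x => \sum_(k <oo) (f k x)%:E).
  apply/integrableP; split.
    by apply: ge0_emeasurable_sum => // k x _; rewrite lee_fin.
  rewrite (eq_integral (fun x => \sum_(k <oo) (f k x)%:E)); last first.
    by move=> x _; rewrite gee0_abs// nneseries_ge0// => k _ _; rewrite lee_fin.
  rewrite integral_nneseries//; last by move=> k x _; rewrite lee_fin.
  apply: le_lt_trans (ltry C); apply: le_trans (epsilon_trick0 xpredT C0).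
  by apply: lee_nneseries => // k _ _; apply: integral_ge0 => x _; rewrite lee_fin.
apply: filterS (integrable_ae measurableT sum_int) => x /(_ I) sumfin.
apply: cvg_series_cvg_0; apply: nondecreasing_is_cvgn.
  by apply: nondecreasing_series => k _ _.
exists (fine (\sum_(k <oo) (f k x)%:E)) => _ [n _ <-].
rewrite -lee_fin fineK// /series/= -sumEFin.
by apply: nneseries_lim_ge => k _ _; rewrite lee_fin.
Qed.

End nonneg_integral.

(* Inference only finds a measure structure on [k x]; naming it allows a probability
   structure to be attached. *)
Section pker_probability.
Context d1 d2 (T1 : measurableType d1) (T2 : measurableType d2) (R : realType).
Variables (k : R.-pker T1 ~> T2) (x : T1).

Definition pker_at : set T2 -> \bar R := k x.

HB.instance Definition _ := Measure.on pker_at.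

HB.instance Definition _ :=
  Measure_isProbability.Build _ _ _ pker_at (prob_kernel x).

End pker_probability.

(** * Summation of the one-step estimates along the chain *)

Section markov_process_integral.
Local Open Scope ereal_scope.
Context (R : realType) (d : nat) (S : set (Rvec R d)).
Context (K : R.-pker Rvec R d ~> Rvec R d) (x0 : Rvec R d).
Context (dO : measure_display) (Omega : measurableType dO).
Context (P : probability Omega R) (X : nat -> Omega -> Rvec R d).
Hypothesis hX : markov_process S K x0 P X.

Let mX n := markov_measurable hX n.

(** Both sides integrate [f] against a measure on the state space: the law of [X n.+1], and the
    mixture of the laws [K (X n w)]. The two measures agree on Borel sets by the Markov property. *)
Lemma markov_integralS n (f : Rvec R d -> \bar R) : (forall y, 0 <= f y) ->
  measurable_fun setT f ->
  \int[P]_w f (X n.+1 w) = \int[P]_w \int[K (X n w)]_y f y.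
Proof.
move=> f0 mf.
(* As a measurable map into the Giry space, the kernel along the chain has the mixture as its
   monadic bind. *)
pose kn w : giry (Rvec R d) R := pker_at K (X n w).
have mkn : measurable_fun setT kn.
  apply: measurable_giry_codensity => // B mB.
  exact: measurableT_comp (measurable_kernel K B mB) (mX n).
(* The Markov property is applied to the whole space as event of the past, namely the complement of
   the empty set. *)
have fullE : g_sigma_preimage (fun k : 'I_n.+1 => X k) setT.
  have [s0 sC _] := smallest_sigma_algebra setT
    (\big[setU/set0]_(i < n.+1) preimage_set_system setT (X i) measurable).
  by rewrite -(setD0 setT); exact: sC.
have := giry_int_bind (P : giry Omega R) mkn mf f0; rewrite /giry_int => <-.
(* Writing the domain as a preimage gives the form required by the change of variables. *)
rewrite -[LHS]/(\int[P]_(x in X n.+1 @^-1` setT) (f \o X n.+1) x).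
rewrite -(ge0_integral_pushforward (mX n.+1) P)//.
apply: eq_measure_integral => B mB _.
transitivity (P (setT `&` X n.+1 @^-1` B)); first by rewrite setTI.
rewrite (markov_step hX fullE mB).
rewrite /giry_bind/=.
have := giry_int_map mkn (P : giry Omega R) (measurable_giry_ev mB).
by rewrite /giry_int/= => ->.
Qed.

Variables (c C : R) (B : set (Rvec R d)).
Hypotheses (c0 : (0 < c)%R) (C0 : (0 <= C)%R) (mB : measurable B).
Hypothesis drift : forall x, S x ->
  (bracket x + c * \1_B x)%:E <= \int[K x]_y (bracket y)%:E.
Hypothesis second_moment : forall x, S x ->
  \int[K x]_y (bracket y ^+ 2)%:E <= (bracket x ^+ 2 + C)%:E.

Let mbracket n : measurable_fun setT (fun w => bracket (X n w)).
Proof. exact: (measurableT_comp (@measurable_bracket R d) (mX n)). Qed.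

Let mind n : measurable_fun setT (fun w => \1_B (X n w) : R).
Proof. exact: (measurableT_comp (measurable_indic mB) (mX n)). Qed.

Let measurable_expect f : (forall y, 0 <= f y) -> measurable_fun setT f ->
  forall n, measurable_fun setT (fun w => \int[K (X n w)]_y f y).
Proof.
move=> f0 mf n.
have mKf : measurable_fun setT (fun x => \int[K x]_y f y).
  by apply: measurable_fun_integral_kernel => // U mU; exact: measurable_kernel.
exact: (measurableT_comp mKf (mX n)).
Qed.

Let integral_cstP r : \int[P]_w (cst r%:E w) = r%:E.
Proof. by rewrite integral_cst//= (@probability_setT _ _ _ P) mule1. Qed.

Lemma expect_bracket_sqr_le n :
  \int[P]_w (bracket (X n w) ^+ 2)%:E <= (bracket x0 ^+ 2 + n%:R * C)%:E.
Proof.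
elim: n => [|n IHn].
  rewrite mul0r addr0 (eq_integral (cst (bracket x0 ^+ 2)%:E)); last first.
    by move=> w _; rewrite (markov_start hX).
  by rewrite integral_cstP.
have mb2 : measurable_fun setT (fun y : Rvec R d => (bracket y ^+ 2)%:E).
  by apply/measurable_EFinP/measurable_funX; exact: measurable_bracket.
have b20 (y : Rvec R d) : 0 <= (bracket y ^+ 2)%:E by rewrite lee_fin sqr_ge0.
rewrite (@markov_integralS n (fun y => (bracket y ^+ 2)%:E))//.
apply: (@le_trans _ _ (\int[P]_w ((bracket (X n w) ^+ 2)%:E + C%:E))).
  apply: ge0_le_integral => //.
  - by move=> w _; exact: integral_ge0.
  - exact: measurable_expect.
  - apply: emeasurable_funD => //.
    exact: (measurableT_comp mb2 (mX n)).
  - by move=> w _; rewrite -EFinD; apply: second_moment; exact: (markov_in hX).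
rewrite ge0_integralD//; last exact: (measurableT_comp mb2 (mX n)).
rewrite integral_cstP mulrSr mulrDl mul1r addrA EFinD.
exact: leeD.
Qed.

(** Telescoping: each step raises the expected bracket by at least [c] times the probability of
    being in [B], and the initial value is nonnegative. *)
Lemma expect_visits_le n :
  \sum_(k < n) c%:E * \int[P]_w (\1_B (X k w))%:E <= \int[P]_w (bracket (X n w))%:E.
Proof.
elim: n => [|n IHn].
  by rewrite big_ord0; apply: integral_ge0 => w _; rewrite lee_fin sqrtr_ge0.
have mb : measurable_fun setT (fun y : Rvec R d => (bracket y)%:E).
  by apply/measurable_EFinP; exact: measurable_bracket.
have b0 (y : Rvec R d) : 0 <= (bracket y)%:E by rewrite lee_fin sqrtr_ge0.
rewrite big_ord_recr/= (@markov_integralS n (fun y => (bracket y)%:E))//.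
have mbn : measurable_fun setT (fun w => (bracket (X n w))%:E).
  exact/measurable_EFinP.
have mi : measurable_fun setT (fun w => (\1_B (X n w) : R)%:E).
  exact/measurable_EFinP.
have mci : measurable_fun setT (fun w => c%:E * (\1_B (X n w))%:E).
  exact: measurable_funeM.
have ci0 w : 0 <= c%:E * (\1_B (X n w))%:E by rewrite mule_ge0// lee_fin// ltW.
apply: (@le_trans _ _ (\int[P]_w ((bracket (X n w))%:E + c%:E * (\1_B (X n w))%:E))).
  rewrite ge0_integralD// ge0_integralZl//; first exact: leeD.
  by rewrite lee_fin ltW.
apply: ge0_le_integral => //.
- by move=> w _; rewrite adde_ge0.
- exact: emeasurable_funD.
- exact: measurable_expect.
- by move=> w _; rewrite -EFinM -EFinD; apply: drift; exact: (markov_in hX).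
Qed.

(** The pointwise inequality [2 b <= t + b^2 / t] deduces the first moment from the second, in place
    of Jensen's inequality. *)
Lemma expect_bracket_le n (t : R) : (0 < t)%R ->
  \int[P]_w (bracket (X n w))%:E
    <= (2^-1 * (t + t^-1 * (bracket x0 ^+ 2 + n%:R * C)))%:E.
Proof.
move=> t0.
have mb2 : measurable_fun setT (fun w => (bracket (X n w) ^+ 2)%:E).
  by apply/measurable_EFinP/measurable_funX.
have b20 w : 0 <= (bracket (X n w) ^+ 2)%:E by rewrite lee_fin sqr_ge0.
have half0 : (0 <= 2^-1 :> R)%R by [].
apply: (@le_trans _ _ (\int[P]_w ((2^-1 * t)%:E
    + (2^-1 * t^-1)%:E * (bracket (X n w) ^+ 2)%:E))).
  apply: ge0_le_integral => //.
  - by move=> w _; rewrite lee_fin sqrtr_ge0.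
  - exact/measurable_EFinP.
  - by apply: emeasurable_funD => //; exact: measurable_funeM.
  - move=> w _; rewrite -EFinM -EFinD lee_fin.
    rewrite -subr_ge0 [X in (0 <= X)%R](_ : _ =
      2^-1 * t^-1 * (bracket (X n w) - t) ^+ 2)%R.
      by rewrite mulr_ge0 ?sqr_ge0// mulr_ge0// invr_ge0 ltW.
    by field; rewrite gt_eqF.
have tV0 : (0 <= 2^-1 * t^-1)%R by rewrite mulr_ge0// invr_ge0 ltW.
rewrite ge0_integralD//; last 3 first.
- by move=> w _; rewrite lee_fin mulr_ge0// ltW.
- by move=> w _; rewrite mule_ge0.
- exact: measurable_funeM.
rewrite integral_cstP ge0_integralZl//.
rewrite mulrDr EFinD leeD2l// mulrA [leRHS]EFinM.
apply: lee_wpmul2l => //; exact: expect_bracket_sqr_le.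
Qed.

Lemma expect_occupation_le n :
  \int[P]_w (occupation X B n w)%:E
    <= (2^-1 * (1 + bracket x0 ^+ 2 + C) / c / Num.sqrt n%:R)%:E.
Proof.
(* At [n = 0] both sides vanish, the inverse of 0 being 0. *)
have [->|n0] := posnP n.
  rewrite sqrtr0 invr0 mulr0 integral0_eq// => w _.
  by rewrite /occupation invr0 mul0r.
have nR0 : (0 < n%:R :> R)%R by rewrite ltr0n.
set s := Num.sqrt n%:R.
have s0 : (0 < s)%R by rewrite sqrtr_gt0.
have ss : (s ^+ 2 = n%:R)%R by rewrite sqr_sqrtr.
have s1 : (1 <= s)%R by rewrite -[leLHS]sqrtr1 ler_wsqrtr// ler1n.
rewrite (eq_integral (fun w =>
    (n%:R^-1)%:E * \sum_(k < n) (\1_B (X k w))%:E)); last first.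
  by move=> w _; rewrite /occupation EFinM sumEFin.
have mi k : measurable_fun setT (fun w => (\1_B (X k w) : R)%:E).
  exact/measurable_EFinP.
have msum : measurable_fun setT (fun w => \sum_(k < n) (\1_B (X k w) : R)%:E).
  by apply: emeasurable_sum => k; exact: mi.
have sum0 w : 0 <= \sum_(k < n) (\1_B (X k w) : R)%:E.
  by apply: sume_ge0 => k _; rewrite lee_fin.
have nV0 : 0 <= (n%:R^-1 : R)%:E by rewrite lee_fin invr_ge0 ltW.
rewrite ge0_integralZl// ge0_integral_sum//.
set T := \sum_(k < n) _.
(* The choice [t = sqrt n] makes both terms of [expect_bracket_le] of order [sqrt n]. *)
have cT : c%:E * T <= (2^-1 * (s + s^-1 * (bracket x0 ^+ 2 + n%:R * C)))%:E.
  rewrite ge0_sume_distrr; last first.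
    by move=> k _; apply: integral_ge0 => w _; rewrite lee_fin.
  exact: le_trans (expect_visits_le n) (expect_bracket_le n s0).
rewrite [leLHS](_ : _ = (n%:R^-1 / c)%:E * (c%:E * T)); last first.
  by rewrite muleA -EFinM divfK ?gt_eqF.
have nc0 : 0 <= (n%:R^-1 / c)%:E by rewrite lee_fin divr_ge0 ?invr_ge0// ltW.
apply: (le_trans (lee_wpmul2l nc0 cT)).
(* The right-hand side exceeds the left-hand one by the displayed quotient, nonnegative because
   [1 <= s]. *)
rewrite -EFinM lee_fin -ss -subr_ge0 [X in (0 <= X)%R](_ : _ =
  bracket x0 ^+ 2 * (s ^+ 2 - 1) / (2 * c * s ^+ 3))%R.
  have s2 : (1 <= s ^+ 2)%R by rewrite -(expr1n _ 2) ler_pXn2r ?nnegrE// ltW.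
  rewrite divr_ge0//; first by rewrite mulr_ge0 ?sqr_ge0// subr_ge0.
  by rewrite !mulr_ge0 ?exprn_ge0// ltW.
by field; rewrite !gt_eqF.
Qed.

End markov_process_integral.

(** Bounds the [q]-th moment of the occupation by its mean. *)
Lemma powR_le_self (R : realType) (t q : R) : 0 <= t -> t <= 1 -> 1 <= q ->
  t `^ q <= t.
Proof.
rewrite le_eqVlt => /predU1P[<-|t0] t1 q1; first by rewrite powR0// gt_eqF//; lra.
by rewrite -[leRHS](powRr1 (ltW t0)) ger_powR// t0.
Qed.

(** * A drift constant uniform over a ball *)

Section drift_constants.
Context (R : realType) (d : nat) (S : set (Rvec R d)).
Context (K : R.-pker Rvec R d ~> Rvec R d) (p Cp v : R).
Hypotheses (p2 : 2 < p) (v0 : 0 < v) (Cp0 : 0 <= Cp).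
Hypothesis moment : forall x, S x ->
  (incr_expect K x (fun D => (enorm D `^ p)%:E) <= Cp%:E)%E.
Hypothesis drift0 : forall x, S x -> forall i : 'I_d,
  incr_expect K x (fun D => (D i 0)%:E) = 0%E.
Hypothesis variance : forall x, S x ->
  (v%:E <= incr_expect K x (fun D => (enorm D ^+ 2)%:E))%E.

(** On the ball [bracket] is at most [sqrt (1 + r^2)], so [truncated_sqr_le] supplies one factor
    [kappa] for all its points. *)
Lemma bracket_drift_ball (r : R) : exists2 c : R, 0 < c & forall x, S x ->
  ((bracket x + c * \1_[set y : Rvec R d | enorm (y : 'cV[R]_d) <= r] x)%:E
    <= \int[K x]_y (bracket y)%:E)%E.
Proof.
(* Small enough that the correction [eta * Cp] stays below [v]; the [+ 1] covers the case
   [Cp = 0]. *)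
pose eta := v / (2 * (Cp + 1)).
have Cp1 : 0 < 2 * (Cp + 1) by rewrite mulr_gt0 ?ltr_wpDl.
have eta0 : 0 < eta by rewrite divr_gt0.
have etaCp : eta * Cp < v.
  rewrite /eta mulrAC ltr_pdivrMr//.
  by rewrite ltr_pM2l//; lra.
pose rho := Num.sqrt (1 + r ^+ 2).
have rho1 : 1 <= rho by rewrite -[leLHS]sqrtr1 ler_wsqrtr// lerDl sqr_ge0.
pose kappa := (2 * rho ^+ 2 * (rho + eta `^ (2 - p)^-1))^-1.
have kappa0 : 0 < kappa.
  have rho0 : 0 < rho by lra.
  by rewrite invr_gt0 !mulr_gt0// ?exprn_gt0// addr_gt0// powR_gt0.
exists (kappa * (v - eta * Cp)); first by rewrite mulr_gt0// subr_gt0.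
move=> x Sx.
have gain k := @bracket_drift_ge _ _ (pker_at K x) _ _ _ _ p2
  (moment Sx) (drift0 Sx) (variance Sx) k eta.
rewrite indicE; case: (boolP (_ \in _)) => [|_].
  rewrite inE/= mulr1 => xr; apply: (gain kappa (ltW kappa0) (ltW eta0)) => t t0.
  apply: truncated_sqr_le => //; first exact: bracket_ge1.
  rewrite ler_wsqrtr// lerD2l -enorm_sqr ler_pXn2r ?nnegrE ?enorm_ge0//.
  exact: le_trans (enorm_ge0 _) xr.
(* Off the ball the factor is 0, which leaves the submartingale inequality. *)
rewrite mulr0 -(mul0r (v - eta * Cp)).
apply: (gain 0 (lexx 0) (ltW eta0)) => t t0.
rewrite mul0r divr_ge0 ?sqr_ge0//.
by rewrite mulr_ge0 ?addr_ge0 ?sqrtr_ge0// mulr_ge0 ?sqr_ge0.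
Qed.

End drift_constants.

(** * Occupation of bounded sets: convergence almost surely and in [L^q] *)

Theorem theorem2p4 (R : realType) (d : nat) (hd : (0 < d)%N)
  (S : set (Rvec R d)) (mS : measurable S) (S_nonempty : S !=set0)
  (S_unbounded : ~ ebounded S)
  (K : R.-pker Rvec R d ~> Rvec R d)
  (dO : measure_display) (Omega : measurableType dO) (P : probability Omega R)
  (X : nat -> Omega -> Rvec R d) (x0 : Rvec R d) (Sx0 : S x0)
  (hX : markov_process S K x0 P X)
  (h1 : exists p : R, 2 < p /\
    (ereal_sup [set incr_expect K x (fun D => (enorm D `^ p)%:E) | x in S]
       < +oo)%E)
  (h2 : forall x, S x -> forall i : 'I_d,
    incr_expect K x (fun D => (D i 0)%:E) = 0%E)
  (h3 : exists v : R, 0 < v /\ forall x, S x ->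
    (v%:E <= incr_expect K x (fun D => (enorm D ^+ 2)%:E))%E)
  (sigma2 : 'cV[R]_d -> 'M[R]_d)
  (h4pos : forall u, usphere u -> posdef (sigma2 u))
  (h4 : cov_err K S sigma2 r @[r --> +oo] --> 0%E)
  (U V : R) (hU : 0 < U) (hUV : U < V)
  (h5 : forall u, usphere u ->
    (u^T *m sigma2 u *m u) 0 0 = U /\ \tr (sigma2 u) = V)
  (hcase : [\/ 2 * U < V, 2 * U > V |
    2 * U = V /\
    exists delta0 : R, 0 < delta0 /\ exists C : R,
      \forall r \near +oo, (cov_err K S sigma2 r <= (C * r `^ (- delta0))%:E)%E])
  (A : set 'cV[R]_d) (hA : ebounded A) :
  {ae P, forall w, occupation X A n w @[n --> \oo] --> (0 : R)} /\
  forall q : R, 1 <= q ->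
    'N[P]_(q%:E)[EFin \o occupation X A n]%E @[n --> \oo] --> 0%E.
Proof.
have [p [p2 supp]] := h1; have [v [v0 variance]] := h3; have [r Ar] := hA.
set moments := [set _ | _ in _] in supp.
have moment_le x : S x ->
    (incr_expect K x (fun D => (enorm D `^ p)%:E) <= ereal_sup moments)%E.
  by move=> Sx; apply: ereal_sup_ubound; exists x.
(* The value at [x0] excludes a supremum equal to [-oo], so with [supp] it is a real number. *)
have sup0 : (0 <= ereal_sup moments)%E.
  apply: le_trans (moment_le _ Sx0); apply: integral_ge0 => y _.
  by rewrite lee_fin powR_ge0.
pose Cp := fine (ereal_sup moments).
have Cp0 : 0 <= Cp by exact: fine_ge0.
have moment x : S x -> (incr_expect K x (fun D => (enorm D `^ p)%:E) <= Cp%:E)%E.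
  by move=> Sx; rewrite fineK ?ge0_fin_numE//; exact: moment_le.
have [c c0 drift] := bracket_drift_ball p2 v0 Cp0 moment h2 variance r.
(* A closed Euclidean ball containing [A]. It is Borel, so the estimates are made for [B] and passed
   to [A] by monotonicity. *)
set B := [set y : Rvec R d | _] in drift.
have mB : measurable B.
  rewrite (_ : B = (fun y : Rvec R d => enorm ((y : 'cV[R]_d) - 0)) @^-1` `]-oo, r]).
    by rewrite -[X in measurable X]setTI; exact: measurable_enormB.
  by apply/seteqP; split => y; rewrite /B/= subr0 in_itv.
have Cp1 : 0 <= 1 + Cp by rewrite addr_ge0.
have second_moment x : S x ->
    (\int[K x]_y (bracket y ^+ 2)%:E <= (bracket x ^+ 2 + (1 + Cp))%:E)%E.
  move=> Sx; exact: (@bracket_sqr_step_le _ _ (pker_at K x) _ _ _ p2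
    (moment _ Sx) (h2 _ Sx)).
have := expect_occupation_le hX c0 Cp1 mB drift second_moment.
set H := _ / c => occ_le.
have H0 : 0 <= H.
  by rewrite divr_ge0 ?(ltW c0)// mulr_ge0// !addr_ge0// sqr_ge0.
clearbody H.
have occ0 D n w : 0 <= occupation X D n w.
  by rewrite mulr_ge0 ?invr_ge0// sumr_ge0.
have occAB n w : occupation X A n w <= occupation X B n w.
  rewrite ler_wpM2l ?invr_ge0//; apply: ler_sum => k _.
  rewrite !indicE ler_nat; case: (boolP (X k w \in A)) => [|//].
  by rewrite inE => /Ar XB; rewrite mem_set.
have occ1 n w : occupation X A n w <= 1.
  have [->|n0] := posnP n; first by rewrite /occupation invr0 mul0r.
  rewrite /occupation mulrC ler_pdivrMr ?ltr0n// mul1r.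
  rewrite -[n in leRHS]card_ord -sum1_card natr_sum.
  by apply: ler_sum => k _; rewrite indicE; case: (_ \in _).
have mocc n : measurable_fun [set: Omega] (occupation X B n).
  apply: measurable_funM => //; apply: measurable_sum => k.
  exact: (measurableT_comp (measurable_indic mB) (markov_measurable hX k)).
split.
  have /= := @ae_cvg0_summable _ _ _ P (fun k => occupation X B (4 ^ k.+1)) H H0.
  move=> /(_ (fun k => mocc _) (fun k w => occ0 B _ w)) ae_sub.
  have {}ae_sub := ae_sub _.
  apply: filterS (ae_sub _) => [w sub0|k]; last first.
    (* Since [sqrt (4^(k+1)) = 2^(k+1)], the bound is the summable [H / 2^(k+1)]. *)
    rewrite (le_trans (occ_le _))// -[4%N]/(2 ^ 2)%N -expnM mulnC expnM natrX.
    by rewrite sqrtr_sqr ger0_norm.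
  apply: (@squeeze_cvgr _ _ _ _ (cst 0) (fun n => occupation X B n w)).
  - by apply: nearW => n; rewrite occ0 occAB.
  - exact: cvg_cst.
  - exact: (mean_cvg0_subseq4 (u := fun k => \1_B (X k w))).
move=> q q1.
have q0 : 0 < q by exact: lt_le_trans q1.
have qn0 : q != 0 by rewrite gt_eqF.
(* The [q]-th moment is at most the mean, hence at most [H / sqrt n]; the norm is bounded by the
   power [1/q] of this. *)
apply: (@squeeze_cvge _ _ _ _ (cst 0%E) _
  (fun n => ((H / Num.sqrt n%:R) `^ q^-1)%:E)); last 2 first.
- exact: cvg_cst.
- apply: cvg_EFin; first exact: nearW.
  apply/cvgr0Pnorm_lt => e e0; near=> n.
  have eq0 : 0 < e `^ q by exact: powR_gt0.
  (* This is [H / sqrt n < e^q] solved for [n]. *)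
  have Hn : (H / e `^ q) ^+ 2 < n%:R by near: n; exact: nbhs_infty_gtr.
  have n0 : 0 < n%:R :> R by apply: le_lt_trans Hn; exact: sqr_ge0.
  rewrite /= ger0_norm ?powR_ge0//.
  rewrite [ltRHS](_ : e = (e `^ q) `^ q^-1); last first.
    by rewrite -powRrM mulfV// powRr1// ltW.
  apply: gt0_ltr_powR; rewrite ?invr_gt0 ?nnegrE ?divr_ge0 ?sqrtr_ge0 ?powR_ge0//.
  rewrite ltr_pdivrMr ?sqrtr_gt0// mulrC -ltr_pdivrMr//.
  rewrite -(ltr_pXn2r (n:=2)) ?nnegrE ?sqrtr_ge0 ?divr_ge0 ?powR_ge0//.
  by rewrite sqr_sqrtr// ltW.
- apply: nearW => n; rewrite Lnorm_ge0/= unlock /Lnorm -poweR_EFin.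
  apply: gt0_ler_poweR; rewrite ?invr_ge0 ?(ltW q0) ?in_itv//= ?leey ?andbT.
  + by apply: integral_ge0 => w _; rewrite lee_fin powR_ge0.
  + by rewrite lee_fin divr_ge0 ?sqrtr_ge0.
  (* The integrand built on [A] may be nonmeasurable; it is compared pointwise with the occupation
     of [B]. *)
  apply: le_trans (occ_le n); apply: ge0_le_integral_nonmeasurable => w.
    by rewrite lee_fin powR_ge0.
  rewrite lee_fin ger0_norm// (le_trans _ (occAB n w))//.
  exact: powR_le_self.
Unshelve. all: by end_near.
Qed.
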